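(* Let $X\subset\mathbb{R}^{2n}$ be a symplectically self-polar convex body with $C^2$-smooth boundary. Let $\gamma\colon I\to\partial X$ ($I$ an interval) be a characteristic curve of $\partial X$, and suppose that $\delta=f\circ\gamma$ is also a characteristic curve of $\partial X$. Then $\gamma$ and $\delta$ are planar curves: both are contained in a two-dimensional linear subspace of $\mathbb{R}^{2n}$.
   Context: $\mathbb{R}^{2n}\cong\mathbb{C}^n$, $J$ is multiplication by $\sqrt{-1}$, $\omega(u,v)=\langle Ju,v\rangle$. For a convex body $X$ with origin in its interior, $X^\omega=\{y: \omega(x,y)\le 1\ \forall x\in X\}$; $X$ is symplectically self-polar if $X=X^\omega$. For $C^1$ boundary, $f\colon\partial X\to\partial X^\omega$ assigns to $x$ the unique $f(x)\in X^\omega$ with $\omega(x,f(x))=1$; when $X=X^\omega$, $f$ maps $\partial X$ to itself. The characteristic line of a hypersurface $\Sigma$ at $p$ is $\ker(\omega|_{T_p\Sigma})$; a characteristic curve of $\Sigma$ is a $C^1$ curve in $\Sigma$ whose velocity at each time lies in the characteristic line at the current point. *)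

(* Defs.v *)
From HB Require Import structures.
From mathcomp Require Import all_boot all_order all_algebra.
From mathcomp Require Import all_classical all_reals all_analysis.
Set Implicit Arguments. Unset Strict Implicit. Unset Printing Implicit Defensive.
Import Order.TTheory GRing.Theory Num.Theory.
Import numFieldNormedType.Exports.
Local Open Scope classical_set_scope.
Local Open Scope ring_scope.

Section SymplecticDefs.
Variables (R : realType) (n : nat).
Local Notation V := 'rV[R]_(n + n).

(* Identification R^{2n} = C^n : v = (x, y) (first block = real parts,
   second block = imaginary parts), z_k = x_k + i y_k.  J = multiplication
   by sqrt(-1) : J (x, y) = (-y, x). *)
Definition Jmul (v : V) : V := row_mx (- rsubmx v) (lsubmx v).

Definition dotp (u v : V) : R := \sum_(i < n + n) u ord0 i * v ord0 i.

Definition omega (u v : V) : R := dotp (Jmul u) v.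

Definition convex_body (X : set V) : Prop :=
  compact X /\ (X°) !=set0 /\
  (forall x y (t : R), X x -> X y -> 0 <= t <= 1 -> X (t *: x + (1 - t) *: y)).

Definition symp_polar (X : set V) : set V :=
  [set y | forall x, X x -> omega x y <= 1].

Definition symp_self_polar (X : set V) : Prop := X = symp_polar X.

(* the map f : dX -> dX^omega ; f(x) = the (unique) y in X^omega with
   omega(x, y) = 1 *)
Definition fsymp (X : set V) (x : V) : V :=
  xget 0 [set y | symp_polar X y /\ omega x y = 1].

Definition bd (X : set V) : set V := closure X `\` X°.

(* C^2 on an open set: all second directional derivatives exist and are
   continuous (equivalent, in finite dimension, to being C^2) *)
Definition C2_on (U : set V) (g : V -> R) : Prop :=
  forall u v : V,
    (forall x, U x -> derivable g x u /\ derivable ('D_u g) x v) /\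
    (forall x, U x -> {for x, continuous ('D_v ('D_u g))}).

Definition C2_boundary (X : set V) : Prop :=
  forall p, bd X p ->
    exists (U : set V) (rho : V -> R),
      [/\ open U, U p, C2_on U rho, (exists v : V, 'D_v rho p != 0) &
          forall x, U x -> (X x <-> rho x <= 0)].

Definition tangent (S : set V) (p : V) : set V :=
  [set w | exists (c : R -> V) (e : R), 0 < e /\ c 0 = p /\
           (forall t, `|t| < e -> S (c t)) /\ derivable c 0 1 /\
           'D_1 c 0 = w].

Definition char_line (S : set V) (p : V) : set V :=
  [set v | tangent S p v /\ (forall w, tangent S p w -> omega v w = 0)].

(* derivative of c : R -> V at t relative to the set I (one-sided at
   endpoints of an interval) *)
Definition has_deriv_within (I : set R) (c : R -> V) (t : R) (v : V) : Prop :=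
  (fun s => (s - t)^-1 *: (c s - c t)) @ within I t^' --> v.

Definition char_curve (S : set V) (I : set R) (c : R -> V) : Prop :=
  exists c' : R -> V,
    [/\ forall t, I t -> has_deriv_within I c t (c' t),
        {within I, continuous c'},
        forall t, I t -> S (c t) &
        forall t, I t -> char_line S (c t) (c' t)].

End SymplecticDefs.

(* Main.v *)
Require Import Defs.
From HB Require Import structures.
From mathcomp Require Import all_boot all_order all_algebra.
From mathcomp Require Import all_classical all_reals all_analysis.
From mathcomp Require Import ring lra.
Import Order.TTheory GRing.Theory Num.Theory.
Import numFieldNormedType.Exports.
Local Open Scope classical_set_scope.
Local Open Scope ring_scope.

(* A self-polar body satisfies X = -X. If x, y in X and omega x y = 1, then y
   spans the characteristic line of dX at x: omega(., y) = 1 supports X at x,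
   and smoothness of dX makes every w with omega w y = 0 tangent, as the
   velocity of the radial projection of x + t w to dX. Since
   omega (f x) (- x) = 1, this gives gamma' = a delta and delta' = b gamma. The
   bivector gamma /\ delta thus has derivative zero, and as
   omega gamma delta = 1 it determines the plane spanned by gamma and delta. *)

(** * Algebra of the standard symplectic form *)

Section SymplecticForm.
Context {R : realType} {n : nat}.
Implicit Types u v w x y z : 'rV[R]_(n + n).

Lemma omegaE u v : omega u v =
  \sum_(i < n) (u ord0 (lshift n i) * v ord0 (rshift n i)
                - u ord0 (rshift n i) * v ord0 (lshift n i)).
Proof.
rewrite /omega /dotp big_split_ord /= -big_split /=; apply: eq_bigr => i _.
by rewrite /Jmul row_mxEl row_mxEr !mxE mulNr addrC.
Qed.

Lemma omegaDl u v w : omega (u + v) w = omega u w + omega v w.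
Proof.
rewrite !omegaE -big_split /=; apply: eq_bigr => i _.
by rewrite !mxE; ring.
Qed.

Lemma omegaZl a u w : omega (a *: u) w = a * omega u w.
Proof.
rewrite !omegaE mulr_sumr; apply: eq_bigr => i _.
by rewrite !mxE; ring.
Qed.

Lemma omegaC u v : omega u v = - omega v u.
Proof.
rewrite !omegaE -sumrN; apply: eq_bigr => i _; ring.
Qed.

Lemma omegaDr u v w : omega w (u + v) = omega w u + omega w v.
Proof. by rewrite omegaC omegaDl opprD -!omegaC. Qed.

Lemma omegaZr a u w : omega w (a *: u) = a * omega w u.
Proof. by rewrite omegaC omegaZl -mulrN -omegaC. Qed.

Lemma omegaNl u w : omega (- u) w = - omega u w.
Proof. by rewrite -scaleN1r omegaZl mulN1r. Qed.

Lemma omegaNr u w : omega w (- u) = - omega w u.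
Proof. by rewrite -scaleN1r omegaZr mulN1r. Qed.

Lemma omegavv u : omega u u = 0.
Proof. by have := omegaC u u; lra. Qed.

(** Pairing with the basis vector of the conjugate coordinate isolates one coordinate of [u - v] up
    to sign. *)
Lemma omega_nondegenerate u v : (forall z, omega z u = omega z v) -> u = v.
Proof.
move=> uv; apply/rowP => j; apply/eqP; rewrite -subr_eq0.
have {}uv z : omega z (u - v) = 0 by rewrite omegaDr omegaNr uv subrr.
set d := u - v in uv *.
have d0 i : d ord0 i = 0.
  have [k ->|k ->] := split_ordP i.
    have := uv (delta_mx ord0 (rshift n k)).
    rewrite omegaE (bigD1 k) //= big1 => [|l /negPf lk].
      by rewrite !mxE !eqxx eq_lrshift /=; lra.
    by rewrite !mxE eq_lrshift eq_rshift lk /=; lra.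
  have := uv (delta_mx ord0 (lshift n k)).
  rewrite omegaE (bigD1 k) //= big1 => [|l /negPf lk].
    by rewrite !mxE !eqxx eq_rlshift /=; lra.
  by rewrite !mxE eq_rlshift eq_lshift lk /=; lra.
by have := d0 j; rewrite !mxE => ->.
Qed.

Lemma omega_continuous u : continuous (omega u).
Proof.
rewrite /omega /dotp; apply: (continuous_big add_continuous).
move=> i _ v; apply: (@continuousM _ _ (cst (Jmul u ord0 i)) (fun w => w ord0 i)).
  exact: cst_continuous.
exact: coord_continuous.
Qed.

End SymplecticForm.

(** * Linearity of directional derivatives *)

Section DirectionalDerivative.
Set Implicit Arguments. Unset Strict Implicit.
Context {R : realType} {V : normedModType R}.
Implicit Types (g : V -> R) (x z u v : V) (k s t : R).

Lemma is_derive_line g z v s :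
  derivable g (s *: v + z) v ->
  is_derive s 1 (fun s => g (s *: v + z)) ('D_v g (s *: v + z)).
Proof.
have E : (fun h : R => h^-1 *: (((fun s => g (s *: v + z)) \o shift s) (h *: 1)
            - g (s *: v + z))) =
         (fun h => h^-1 *: ((g \o shift (s *: v + z)) (h *: v)
            - g (s *: v + z))).
  by apply/funext => h; rewrite /= scalerDl addrA /GRing.scale /= mulr1.
by move=> dg; split; rewrite /derivable /derive E.
Qed.

Lemma line_MVT g z v (t : R) : 0 < t ->
  (forall s, 0 <= s <= t -> derivable g (s *: v + z) v) ->
  exists2 s, 0 < s < t & g (t *: v + z) - g z = t * 'D_v g (s *: v + z).
Proof.
move=> t0 dg.
have [||s /[!in_itv]/= s0t] := @MVT R (fun s => g (s *: v + z))
  (fun s => 'D_v g (s *: v + z)) 0 t t0.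
- move=> s /[!in_itv]/= /andP[s0 st].
  by apply: is_derive_line; apply: dg; rewrite !ltW.
- apply: derivable_within_continuous => s /[!in_itv]/= s0t.
  by have [] := is_derive_line (dg s s0t).
by rewrite scale0r add0r subr0 mulrC => E; exists s.
Qed.


Lemma line_cvg_right x u : (h *: u + x) @[h --> (0 : R)^'+] --> x.
Proof.
rewrite -[X in _ --> X]add0r -(scale0r u); apply: cvg_at_right_filter.
apply: cvgD; last exact: cvg_cst.
by apply: cvgZr_tmp; exact: cvg_id.
Qed.

Lemma scale_sub_cvg0 k x : k *: (u - x) @[u --> x] --> (0 : V).
Proof.
rewrite -(scaler0 _ k) -[X in _ *: X](subrr x).
by apply: cvgZl_tmp; apply: cvgB; [exact: cvg_id|exact: cvg_cst].
Qed.

Lemma derivable_cvg_right g x v : derivable g x v ->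
  h^-1 * (g (h *: v + x) - g x) @[h --> 0^'+] --> 'D_v g x.
Proof. by move=> dg; exact: (cvg_dnbhs_at_right (f := fun h => h^-1 * _)). Qed.

Lemma derivable_line_continuous_right g x v : derivable g x v ->
  g (h *: v + x) @[h --> (0 : R)^'+] --> g x.
Proof.
move=> dg.
have : {for 0, continuous (fun h : R => g (h *: v + x))}.
  by move/derivable1P/derivable1_diffP: dg; exact: differentiable_continuous.
by move=> /cvg_at_right_filter /=; rewrite scale0r add0r.
Qed.

(** Chain rule for the reparametrisation [s * k] of the line through [x]; it uses differentiability
    along [v] only and covers [k = 0]. *)
Lemma deriveZv g x v k : derivable g x v -> 'D_(k *: v) g x = k * 'D_v g x.
Proof.
move=> dg; have := @is_derive_line g x (k *: v) 0.
rewrite scale0r add0r => dkv.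
have d1 : is_derive ((fun s : R => s * k) 0) 1 (fun s => g (s *: v + x)) ('D_v g x).
  rewrite mul0r -[in 'D_v g x](add0r x) -(scale0r v); apply: is_derive_line.
  by rewrite scale0r add0r.
have d2 : is_derive (0 : R) 1 (fun s : R => s * k) k.
  by apply: is_derive_eq; rewrite ?scaler0 ?add0r /GRing.scale /= ?mulr1.
have [d3 d3E] := @is_derive1_comp _ _ (fun s : R => s * k) _ _ _ d1 d2.
have E : (fun s => g (s *: v + x)) \o (fun s => s * k)
    = (fun h => g (h *: (k *: v) + x)).
  by apply/funext => h /=; rewrite scalerA.
rewrite E in d3 d3E.
have dk : derivable g x (k *: v) by apply/derivable1P.
have [_] := dkv dk.
by rewrite d3E mulrC => ->.
Qed.

(* [g(x+tu+tv) - g(x+tu)] is [t] times a value of ['D_v g] that differs from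
   ['D_v g (x+tu)] by [O(t)] because ['D_v ('D_v g)] is bounded near [x]: so
   no joint differentiability of [g] is needed. *)
Lemma deriveDv g x u v :
  derivable g x u -> derivable g x (u + v) ->
  (\forall z \near x, derivable g z v /\ derivable ('D_v g) z v) ->
  derivable ('D_v g) x u -> {for x, continuous ('D_v ('D_v g))} ->
  'D_(u + v) g x = 'D_u g x + 'D_v g x.
Proof.
move=> du duv dnear dvu cvv.
have qcvg : h^-1 * (g (h *: v + (h *: u + x)) - g (h *: u + x)) @[h --> 0^'+]
    --> 'D_v g x.
  set M := `|'D_v ('D_v g) x| + 1.
  have M0 : 0 < M by rewrite ltr_wpDl.
  have : \forall z \near x, [/\ derivable g z v, derivable ('D_v g) z v &
      `|'D_v ('D_v g) z| <= M].
    have cvvM : \forall z \near x, `|'D_v ('D_v g) x - 'D_v ('D_v g) z| <= 1.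
      by move: cvv => /cvgrPdist_le/(_ 1 ltr01).
    move: dnear cvvM; apply: filterS2 => z [? ?]; rewrite distrC => zd; split=> //.
    by rewrite /M -lerBlDl; exact: le_trans (lerB_dist _ _) zd.
  move=> /nbhs_normP[r r0 good].
  apply/cvgrPdist_le => e e0.
  near=> h.
  have h0 : 0 < h by [].
  (* This keeps every [s *: v + (h *: u + x)] with [0 <= s <= h] in the ball of radius [r]. The
     [+ 1] in the next line avoids a division by zero when [u] and [v] both vanish. *)
  have hr : h * (`|u| + `|v|) < r.
    have c0 : 0 < `|u| + `|v| + 1 by rewrite ltr_wpDl// addr_ge0.
    apply: (@le_lt_trans _ _ (h * (`|u| + `|v| + 1))).
      by rewrite ler_pM2l// lerDl.
    rewrite -ltr_pdivlMr//; near: h.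
    by apply: nbhs_right_lt; rewrite divr_gt0.
  have gd s : 0 <= s <= h -> [/\ derivable g (s *: v + (h *: u + x)) v,
      derivable ('D_v g) (s *: v + (h *: u + x)) v &
      `|'D_v ('D_v g) (s *: v + (h *: u + x))| <= M].
    move=> /andP[s0 sh]; apply: good => /=.
    rewrite addrA opprD addrCA subrr addr0 normrN.
    apply: le_lt_trans hr; rewrite (le_trans (ler_normD _ _))//.
    rewrite !normrZ (ger0_norm s0) (gtr0_norm h0) mulrDr addrC lerD2l.
    by rewrite ler_wpM2r.
  have [s /andP[s0 sh] ->] := line_MVT h0 (fun s hs => let: And3 a _ _ := gd s hs in a).
  rewrite mulKf ?gt_eqF//.
  have [|s' /andP[s'0 s's]] := @line_MVT ('D_v g) (h *: u + x) v s s0.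
    move=> s' /andP[? ?].
    by have [|//] := gd s'; apply/andP; split; lra.
  have [|_ _ DM] := gd s'; first by apply/andP; split; lra.
  have dv1 : `|'D_v g x - 'D_v g (h *: u + x)| <= e / 2.
    near: h.
    have /cvgrPdist_le := derivable_line_continuous_right dvu.
    by apply; rewrite divr_gt0.
  have hM : h * M <= e / 2.
    rewrite -ler_pdivlMr//; near: h.
    by apply: nbhs_right_le; rewrite !divr_gt0.
  move=> E.
  rewrite (_ : _ - _ = ('D_v g x - 'D_v g (h *: u + x))
      - s * 'D_v ('D_v g) (s' *: v + (h *: u + x))); last first.
    by rewrite -E; ring.
  rewrite (le_trans (ler_normB _ _))// [leRHS](splitr e) lerD//.
  apply: le_trans hM; rewrite normrM (gtr0_norm s0).
  by rewrite ler_pM// ltW.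
have sum_cvg := cvgD qcvg (derivable_cvg_right du).
have := derivable_cvg_right duv.
have -> : (fun h => h^-1 * (g (h *: (u + v) + x) - g x)) =
  (fun h => h^-1 * (g (h *: v + (h *: u + x)) - g (h *: u + x)) +
  h^-1 * (g (h *: u + x) - g x)).
  apply/funext => h; rewrite -mulrDr scalerDr.
  rewrite (_ : h *: u + _ + x = h *: v + (h *: u + x)) ?addrA 1?(addrC (h *: u))//.
  by congr (_ * _); ring.
by move=> /cvg_lim <- //; rewrite [RHS]addrC -(cvg_lim _ (sum_cvg _)).
Unshelve. all: by end_near. Qed.

End DirectionalDerivative.

(** * Boundary points of a self-polar body and their dual points *)

Section SelfPolarBody.
Set Implicit Arguments. Unset Strict Implicit.
Context {R : realType} {n : nat} (X : set 'rV[R]_(n + n)).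
Hypothesis compactX : compact X.
Hypothesis intX0 : X° 0.
Hypothesis polarX : symp_self_polar X.
Implicit Types u v w x y z : 'rV[R]_(n + n).

Lemma mem_self_polar x : X x <-> forall z, X z -> omega z x <= 1.
Proof. by rewrite {1}polarX. Qed.

(** Antisymmetry turns [omega z (- x) <= 1] into [omega x z <= 1], which holds because [z] itself
    lies in the polar. *)
Lemma self_polar_opp x : X x -> X (- x).
Proof.
move=> Xx; apply/mem_self_polar => z Xz.
by rewrite omegaNr -omegaC; apply: (mem_self_polar z).1.
Qed.

Lemma mem_self_polarl x : X x <-> forall z, X z -> omega x z <= 1.
Proof.
rewrite mem_self_polar; split=> h z Xz.
  by have := h _ (self_polar_opp Xz); rewrite omegaNl -omegaC.
by have := h _ (self_polar_opp Xz); rewrite omegaNr -omegaC.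
Qed.

Lemma omega_max u : exists2 z, X z & forall z', X z' -> omega u z' <= omega u z.
Proof.
have [||z /set_mem Xz zmax] := @EVT_max_rV _ _ (omega u) X _ compactX.
- by exists 0; exact: nbhs_singleton intX0.
- exact/continuous_subspaceT/omega_continuous.
by exists z => // z' Xz'; apply: zmax; exact: mem_set.
Qed.

(** If [x] were interior, [h *: x + x] would lie in [X] for small [h > 0], although its pairing with
    [z] is [1 + h]. *)
Lemma bd_self_polar x z : X x -> X z -> omega x z = 1 -> bd X x.
Proof.
move=> Xx Xz xz; split; first exact: subset_closure.
move=> ix.
have : \forall h \near (0 : R)^'+, X (h *: x + x).
  exact: line_cvg_right.
move=> Xhx.
near (0 : R)^'+ => h.
have : X (h *: x + x) by near: h.
move=> /mem_self_polarl/(_ _ Xz); rewrite omegaDl omegaZl xz.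
have : 0 < h by [].
lra.
Unshelve. all: by end_near. Qed.


(** Existence of the value of [f] at [x]. If the maximum [M] of [omega x] over [X] were below 1,
    every [u] near [x] would be [x] plus [1 - M] times a point of [X]. Its pairings with [X] would
    then be at most [M + (1 - M) = 1], so [u] would lie in [X] and [x] would be interior. *)
Lemma bd_omega_eq1 x : bd X x -> exists2 y, X y & omega x y = 1.
Proof.
move=> [cx nix].
have Xx : X x.
  by move: cx; rewrite -(closure_id X).1//; exact: compact_closed compactX.
have [z Xz zmax] := omega_max x.
exists z => //; apply/eqP; rewrite eq_le (mem_self_polarl x).1//= leNgt.
apply/negP => lt1; apply: nix; set M := omega x z in zmax lt1 *.
have : \forall u \near x, X ((1 - M)^-1 *: (u - x)).
  exact: (scale_sub_cvg0 (1 - M)^-1 x intX0).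
rewrite /interior; apply: filterS => u Xu.
apply/mem_self_polarl => z' Xz'.
have M1 : 0 < 1 - M by rewrite subr_gt0.
have -> : u = x + (1 - M) *: ((1 - M)^-1 *: (u - x)).
  by rewrite scalerA divff ?gt_eqF// scale1r addrC subrK.
rewrite omegaDl omegaZl; have := zmax _ Xz'.
have := (mem_self_polarl _).1 Xu _ Xz'; nra.
Qed.

(** Moving from [x] along [u] raises the pairing with [y] above 1, hence leaves [X]; there [rho] is
    positive, while [rho x <= 0]. *)
Lemma self_polar_derive_ge0 (U : set 'rV[R]_(n + n)) (rho : 'rV[R]_(n + n) -> R) x y u :
  open U -> U x -> (forall z, U z -> (X z <-> rho z <= 0)) ->
  derivable rho x u -> X x -> X y -> omega x y = 1 -> 0 < omega u y ->
  0 <= 'D_u rho x.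
Proof.
move=> oU Ux Urho du Xx Xy xy uy.
rewrite -(cvg_lim _ (derivable_cvg_right du))//; apply: limr_ge.
  by apply/cvg_ex; exists ('D_u rho x); exact: derivable_cvg_right.
near=> h.
have h0 : 0 < h by [].
have Uh : U (h *: u + x).
  near: h.
  by apply: line_cvg_right; exact: open_nbhs_nbhs.
rewrite mulr_ge0 ?invr_ge0 ?(ltW h0)// subr_ge0.
apply: (@le_trans _ _ 0); first exact/(Urho x Ux).1.
rewrite leNgt; apply/negP => /ltW/(Urho _ Uh).2/mem_self_polarl/(_ _ Xy).
rewrite omegaDl omegaZl xy; nra.
Unshelve. all: by end_near. Qed.

Lemma self_polar_derive_lt0 (U : set 'rV[R]_(n + n)) (rho : 'rV[R]_(n + n) -> R) x u :
  open U -> U x -> (forall z, U z -> (X z <-> rho z <= 0)) ->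
  derivable rho x u -> X x -> 'D_u rho x < 0 ->
  \forall h \near (0 : R)^'+, X (h *: u + x).
Proof.
move=> oU Ux Urho du Xx Du.
near=> h.
have h0 : 0 < h by [].
have Uh : U (h *: u + x).
  near: h.
  by apply: line_cvg_right; exact: open_nbhs_nbhs.
apply/(Urho _ Uh).2/(le_trans _ ((Urho _ Ux).1 Xx)).
have : h^-1 * (rho (h *: u + x) - rho x) <= 0.
  near: h; exact: cvgr_le (derivable_cvg_right du) _ Du.
by rewrite pmulr_rle0 ?invr_gt0// subr_le0.
Unshelve. all: by end_near. Qed.

End SelfPolarBody.

(** * The characteristic line at a boundary point *)

Section CharacteristicLine.
Set Implicit Arguments. Unset Strict Implicit.
Context {R : realType} {n : nat} (X : set 'rV[R]_(n + n)).
Hypothesis compactX : compact X.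
Hypothesis intX0 : X° 0.
Hypothesis polarX : symp_self_polar X.
Hypothesis C2X : C2_boundary X.
Variables x y : 'rV[R]_(n + n).
Hypotheses (Xx : X x) (Xy : X y) (xy : omega x y = 1).
Implicit Types u v w z : 'rV[R]_(n + n).

(** The derivative of [rho] at [x] is linear and nonnegative wherever [omega u y > 0]. So it
    vanishes on the kernel of [omega _ y] and, being nonzero, is positive at [x]. The tilt
    [- e *: x] therefore makes [rho] strictly decrease. *)
Lemma supporting_hyperplane_touch w e : omega w y = 0 -> 0 < e ->
  \forall h \near (0 : R)^'+, X (h *: (w - e *: x) + x).
Proof.
move=> wy e0.
have [U [rho [oU Ux C2 [v Dv] Urho]]] := C2X (bd_self_polar polarX Xx Xy xy).
have dU z u : U z -> derivable rho z u.
  by move=> Uz; have [/(_ z Uz)[]] := C2 u u.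
have DD u1 u2 : 'D_(u1 + u2) rho x = 'D_u1 rho x + 'D_u2 rho x.
  apply: deriveDv; [exact: dU|exact: dU| | |].
  - near=> z; have Uz : U z by near: z; exact: open_nbhs_nbhs.
    by have [/(_ z Uz)] := C2 u2 u2.
  - by have [/(_ x Ux)[]] := C2 u2 u1.
  - by have [_ /(_ x Ux)] := C2 u2 u2.
have DZ k u : 'D_(k *: u) rho x = k * 'D_u rho x.
  by rewrite deriveZv//; exact: dU.
have Dge0 u : 0 < omega u y -> 0 <= 'D_u rho x.
  by move=> uy; apply: (self_polar_derive_ge0 _ oU Ux Urho _ Xx Xy) => //; exact: dU.
have D0 w' : omega w' y = 0 -> 'D_w' rho x = 0.
  move=> wy'; apply/eqP/negPn/negP => Dw.
  (* The coefficient of [w'] makes the derivative of [rho] along this vector equal to [-1], while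
     its pairing with [y] stays 1. *)
  have := Dge0 (x + (- ('D_x rho x + 1) / 'D_w' rho x) *: w').
  rewrite omegaDl omegaZl wy' xy DD DZ divfK// mulr0 addr0 => /(_ ltr01); lra.
have Dx : 0 < 'D_x rho x.
  rewrite lt_neqAle Dge0 ?xy// andbT eq_sym; apply: contraNneq Dv => Dx0.
  have -> : v = omega v y *: x + (v - omega v y *: x) by rewrite addrC subrK.
  rewrite DD DZ Dx0 mulr0 add0r D0// omegaDl omegaNl omegaZl xy; lra.
apply: (self_polar_derive_lt0 oU Ux Urho) => //; first exact: dU.
by rewrite -scaleNr DD DZ D0//; nra.
Unshelve. all: by end_near. Qed.

(** The support function [max omega (h *: w + x) _] over [X] exceeds 1 by only [o(h)]. For [h > 0]
    this is the tilted inclusion, for [h < 0] the same with [- w]. *)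
Lemma support_le w e : omega w y = 0 -> 0 < e ->
  \forall h \near (0 : R), forall z, X z -> omega (h *: w + x) z <= 1 + e * `|h|.
Proof.
have right w' : omega w' y = 0 -> 0 < e -> exists2 d : R, 0 < d &
    forall h, 0 < h < d -> forall z, X z -> omega (h *: w' + x) z <= 1 + e * h.
  move=> wy' e0.
  have /nbhs_ballP[d d0 dX] := supporting_hyperplane_touch wy' e0.
  exists d => // h /andP[h0 hd] z Xz.
  have := dX h; rewrite /= /ball /= sub0r normrN gtr0_norm// => /(_ hd h0).
  move=> /(mem_self_polarl polarX)/(_ _ Xz).
  (* Undoing the tilt adds [h * e * omega x z], which is at most [e * h]. *)
  have := (mem_self_polarl polarX x).1 Xx _ Xz.
  rewrite -subr_ge0 => /(mulr_ge0 (ltW (mulr_gt0 h0 e0))).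
  by rewrite !(omegaDl, omegaZl, omegaNl); lra.
move=> wy e0.
have [d d0 dP] := right _ wy e0.
have [|d' d'0 dP'] := right (- w) _ e0; first by rewrite omegaNl wy oppr0.
near=> h => z Xz.
have /andP[hd hd'] : (`|h| < d) && (`|h| < d').
  rewrite -lt_min; near: h; apply/nbhs_ballP.
  exists (Num.min d d') => /= [|h]; first by rewrite lt_min d0.
  by rewrite /ball/= sub0r normrN.
have [h0|h0|->] := ltgtP h 0; last first.
- rewrite scale0r add0r normr0 mulr0 addr0.
  exact: (mem_self_polarl polarX x).1.
- by rewrite gtr0_norm// dP//; rewrite h0 -(gtr0_norm h0).
- have := dP' (- h); rewrite scalerN scaleNr opprK ltr0_norm// => -> //.
  by rewrite oppr_gt0 h0 -(ltr0_norm h0).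
Unshelve. all: by end_near. Qed.

(** The curve [c] divides [t *: w + x] by [g t], the maximum of its pairings with [X]. By
    self-polarity [g] is the gauge of [X], so [c] runs in the boundary. Testing on [y] gives
    [g >= 1], and [support_le] bounds [g] above, so [g] has derivative 0 at 0 and [c] has velocity
    [w]. *)
Lemma tangent_supporting_hyperplane w : omega w y = 0 -> tangent (bd X) x w.
Proof.
move=> wy.
have [z zP] := choice (fun t : R =>
  (exists2P _ _).1 (omega_max compactX intX0 (t *: w + x))).
have Xz t : X (z t) by have [] := zP t.
have zmax t z' : X z' -> omega (t *: w + x) z' <= omega (t *: w + x) (z t).
  by have [_] := zP t; exact.
pose g t := omega (t *: w + x) (z t).
have g1 t : 1 <= g t.
  by apply: le_trans (zmax t y Xy); rewrite omegaDl omegaZl wy xy mulr0 add0r.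
have gu t : g t != 0 by rewrite gt_eqF// (lt_le_trans ltr01).
have g0 : g 0 = 1.
  apply/eqP; rewrite eq_le g1 andbT /g scale0r add0r.
  exact: (mem_self_polarl polarX x).1.
pose c t := (g t)^-1 *: (t *: w + x).
have bdc t : bd X (c t).
  apply: (bd_self_polar polarX _ (Xz t)); last by rewrite omegaZl mulVf ?gu.
  apply/(mem_self_polarl polarX) => z' Xz'; rewrite omegaZl mulrC ler_pdivrMr.
    by rewrite mul1r zmax.
  exact: lt_le_trans (g1 t).
have c0 : c 0 = x by rewrite /c g0 invr1 scale1r scale0r add0r.
(* [q] is the difference quotient of [1 / g] at 0; that of [c] equals
   [w + (h * q h) *: w + q h *: x]. *)
pose q h := h^-1 * ((g h)^-1 - 1).
have q0 : q h @[h --> (0 : R)^'] --> (0 : R).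
  apply/cvgrPdist_le => e e0; near=> h.
  have h0 : h != 0 by near: h; exact: nbhs_dnbhs_neq.
  have gh : g h <= 1 + e * `|h|.
    have : forall z, X z -> omega (h *: w + x) z <= 1 + e * `|h|.
      near: h; apply: nbhs_dnbhs; exact: support_le.
    exact.
  rewrite sub0r normrN normrM normrV ?unitfE// ler_pdivrMl ?normr_gt0//.
  have -> : (g h)^-1 - 1 = - ((g h - 1) / g h) by field.
  have gp := lt_le_trans ltr01 (g1 h).
  rewrite normrN (@ger0_norm _ (_ / _)); last by rewrite divr_ge0 ?subr_ge0// ltW.
  rewrite ler_pdivrMr//; have := g1 h; have := normr_ge0 h; nra.
have dc : h^-1 *: ((c \o shift 0) (h *: 1) - c 0) @[h --> (0 : R)^'] --> w.
  have : w + (h * q h) *: w + q h *: x @[h --> (0 : R)^'] --> w.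
    rewrite -[X in _ --> X]addr0 -(scale0r x); apply: cvgD; last exact: cvgZr_tmp.
    rewrite -[X in _ --> X]addr0 -(scale0r w); apply: cvgD; first exact: cvg_cst.
    apply: cvgZr_tmp; rewrite -[X in _ --> X](mulr0 0); apply: cvgM => //.
    exact: nbhs_dnbhs.
  apply: cvg_trans; apply: near_eq_cvg; near=> h.
  have h0 : h != 0 by near: h; exact: nbhs_dnbhs_neq.
  rewrite /= addr0 c0 /c /q [_ *: 1]mulr1 mulrA divff// mul1r.
  by apply/rowP => i; rewrite !mxE; field; rewrite h0 gu.
exists c, 1; split=> //; split=> //; split=> [t _ //|].
by split; [apply/cvg_ex; exists w | exact: cvg_lim].
Unshelve. all: by end_near. Qed.

(** Each [z - omega z y *: x] pairs to 0 with [y], hence is tangent and pairs to 0 with [v]. So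
    [omega z v = omega x v * omega z y] for all [z], and nondegeneracy gives [v]. *)
Lemma char_line_supporting v : char_line (bd X) x v -> exists a, v = a *: y.
Proof.
move=> [_ vT]; exists (omega x v); apply: omega_nondegenerate => z.
have : omega v (z - omega z y *: x) = 0.
  apply: vT; apply: tangent_supporting_hyperplane.
  by rewrite omegaDl omegaNl omegaZl xy mulr1 subrr.
rewrite omegaDr omegaNr !omegaZr (omegaC v z) (omegaC v x); lra.
Qed.

End CharacteristicLine.

(** * Scalar pairings of a curve differentiable relative to a set *)

Section DerivativeWithin.
Set Implicit Arguments. Unset Strict Implicit.
Context {R : realType} {n : nat} (I : set R).
Implicit Types (c : R -> 'rV[R]_(n + n)) (v z : 'rV[R]_(n + n)) (s t : R).

Lemma omega_deriv_within c t v z : has_deriv_within I c t v ->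
  (s - t)^-1 * (omega z (c s) - omega z (c t)) @[s --> within I t^']
    --> omega z v.
Proof.
move=> cv; have := cvg_comp _ _ cv (@omega_continuous _ _ z v).
apply: cvg_trans; apply: near_eq_cvg; near=> s.
by rewrite /= omegaZr omegaDr omegaNr.
Unshelve. all: by end_near. Qed.

Lemma omega_continuous_within c t v z : has_deriv_within I c t v ->
  omega z (c s) @[s --> within I (nbhs t)] --> omega z (c t).
Proof.
move=> /(@omega_deriv_within _ _ _ z) qv.
have : (omega z (c t) + (s - t) * ((s - t)^-1 * (omega z (c s) - omega z (c t))))
    @[s --> within I t^'] --> omega z (c t) + (t - t) * omega z v.
  apply: cvgD; first exact: cvg_cst.
  apply: cvgM qv; apply: cvgB; last exact: cvg_cst.
  by apply: cvg_within_filter; exact: nbhs_dnbhs.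
rewrite subrr mul0r addr0 => /cvgrPdist_le cc.
apply/cvgrPdist_le => e e0; have : nbhs t _ := cc e e0.
rewrite /prop_near1 /within; apply: filterS => s sP Is.
(* The limit of the quotient controls only [s] different from [t]; at [s = t] the bound is
   immediate. *)
have [->|st] := eqVneq s t; first by rewrite subrr normr0 ltW.
by have := sP st Is; rewrite mulVKf ?subr_eq0// subrKC.
Qed.

Lemma omega_is_derive c t v z : nbhs t I -> has_deriv_within I c t v ->
  is_derive t 1 (fun s => omega z (c s)) (omega z v).
Proof.
move=> It /(@omega_deriv_within _ _ _ z) qv.
have dq : h^-1 *: (((fun s => omega z (c s)) \o shift t) (h *: 1)
    - omega z (c t)) @[h --> (0 : R)^'] --> omega z v.
  apply/cvgrPdist_le => e e0.
  move/cvgrPdist_le: qv => qv; have tqv : nbhs t _ := qv e e0.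
  have [d d0 dP] := (nbhs_ballP _ _).1 (filterI tqv It).
  apply/nbhs_ballP; exists d => //= h; rewrite /ball /= sub0r normrN => hd h0.
  have [|sP Is] := dP (h + t).
    by rewrite /ball/= opprD addrCA subrr addr0 normrN.
  have := sP _ Is; rewrite addrK [_ *: 1]mulr1; apply.
  by rewrite -subr_eq0 addrK.
by split; [apply/cvg_ex; exists (omega z v)|exact: cvg_lim].
Qed.

End DerivativeWithin.

(** * Constancy of the bivector and planarity *)

Section PlanarCurve.
Set Implicit Arguments. Unset Strict Implicit.
Context {R : realType} {n : nat} (I : set R) (gamma delta : R -> 'rV[R]_(n + n)).
Variables a b : R -> R.
Hypothesis itvI : is_interval I.
Hypothesis dgamma : forall t, I t -> has_deriv_within I gamma t (a t *: delta t).
Hypothesis ddelta : forall t, I t -> has_deriv_within I delta t (b t *: gamma t).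
Hypothesis omega1 : forall t, I t -> omega (gamma t) (delta t) = 1.

(** The bivector of [gamma] and [delta] evaluated on the covectors [omega z] and [omega z']; being
    scalar, it is accessible to the mean value theorem. *)
Let wedge z z' t := omega z (gamma t) * omega z' (delta t)
                    - omega z (delta t) * omega z' (gamma t).

(** The terms with [a] cancel each other, and so do those with [b]. Ordinary derivatives are taken
    only inside the segment, where [I] is a neighbourhood; at [p] and [r], possibly endpoints of
    [I], continuity relative to [I] suffices. *)
Lemma wedge_lt_const z z' p r : I p -> I r -> p < r -> wedge z z' r = wedge z z' p.
Proof.
move=> Ip Ir pr.
have subI : `[p, r] `<=` I.
  by move=> t /= /[!in_itv]/= /itvI; apply.
have [||t _] := @MVT R (wedge z z') (cst 0) p r pr.
- move=> t tpr.
  have nI : nbhs t I.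
    by apply: filterS (near_in_itvoo tpr) => s /subset_itv_oo_cc/subI.
  have It := nbhs_singleton nI.
  have dg w := omega_is_derive w nI (dgamma It).
  have dd w := omega_is_derive w nI (ddelta It).
  have -> : wedge z z' = (fun t => omega z (gamma t)) * (fun t => omega z' (delta t))
     - (fun t => omega z (delta t)) * (fun t => omega z' (gamma t)) by [].
  have := is_deriveB (is_deriveM (dg z) (dd z')) (is_deriveM (dd z) (dg z')).
  move=> h; apply: is_derive_eq.
  by rewrite !omegaZr /GRing.scale /=; ring.
- apply/subspace_continuousP => t /subI It.
  have sub : within `[p, r] (nbhs t) `=>` within I (nbhs t).
    by move=> A; rewrite /within /= !near_simpl; apply: filterS => s AI /subI/AI.
  have cg w : omega w (gamma s) @[s --> within `[p, r] (nbhs t)] --> omega w (gamma t).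
    by move=> A /(omega_continuous_within (dgamma It))/sub.
  have cd w : omega w (delta s) @[s --> within `[p, r] (nbhs t)] --> omega w (delta t).
    by move=> A /(omega_continuous_within (ddelta It))/sub.
  by apply: cvgB; apply: cvgM.
by rewrite mul0r => /eqP; rewrite subr_eq0 => /eqP.
Qed.

Lemma wedge_const z z' s t : I s -> I t -> wedge z z' s = wedge z z' t.
Proof.
move=> Is It; have [st|st|-> //] := ltgtP s t.
  exact/esym/wedge_lt_const.
exact: wedge_lt_const.
Qed.

(** With [gamma t] as first covector, the bivector at time [t] reduces to [- omega z (gamma t)]. Its
    value at time [s] is the pairing of [z] with the opposite of the right-hand side. *)
Lemma gamma_planar s t : I s -> I t -> gamma t =
  omega (gamma t) (delta s) *: gamma s - omega (gamma t) (gamma s) *: delta s.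
Proof.
move=> Is It; apply: omega_nondegenerate => z.
have := wedge_const (gamma t) z It Is.
rewrite /wedge omegavv omega1// omegaDr omegaNr !omegaZr; lra.
Qed.

Lemma delta_planar s t : I s -> I t -> delta t =
  omega (delta t) (delta s) *: gamma s - omega (delta t) (gamma s) *: delta s.
Proof.
move=> Is It; apply: omega_nondegenerate => z.
have := wedge_const (delta t) z It Is.
rewrite /wedge omegavv (omegaC (delta t) (gamma t)) omega1//.
rewrite omegaDr omegaNr !omegaZr; lra.
Qed.

End PlanarCurve.

(** * Symplectic planes and conclusion *)

Lemma exists_omega_eq1 (R : realType) (n : nat) : (0 < n)%N ->
  exists u v : 'rV[R]_(n + n), omega u v = 1.
Proof.
case: n => // n _.
exists (delta_mx ord0 (lshift _ ord0)), (delta_mx ord0 (rshift _ ord0)).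
rewrite omegaE big_ord_recl big1 => [|i _].
  by rewrite !mxE !eqxx !eq_lrshift eq_rlshift /=; lra.
by rewrite !mxE !eq_lshift !eq_lrshift eq_rlshift /=; lra.
Qed.

(** Since [omega] is alternating, it vanishes on any two proportional vectors. *)
Lemma dim_span_omega1 (R : realType) (n : nat) (u v : 'rV[R]_(n + n)) :
  omega u v = 1 -> \dim <<[:: u; v]>> = 2%N.
Proof.
move=> uv; apply/eqP; rewrite -[2%N]/(size [:: u; v]) -/(free [:: u; v]).
rewrite free_cons span_seq1 seq1_free; apply/andP; split; last first.
  apply/eqP => v0; move: uv; rewrite v0 -(scale0r v) omegaZr mul0r => /eqP.
  by rewrite eq_sym oner_eq0.
apply/negP => /vlineP[k E]; move: uv.
by rewrite E omegaZl omegavv mulr0 => /eqP; rewrite eq_sym oner_eq0.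
Qed.

Theorem theorem4p4 (R : realType) (n : nat) (X : set 'rV[R]_(n + n))
    (I : set R) (gamma : R -> 'rV[R]_(n + n)) :
  (0 < n)%N ->
  convex_body X -> X° 0 ->
  symp_self_polar X ->
  C2_boundary X ->
  is_interval I ->
  char_curve (bd X) I gamma ->
  char_curve (bd X) I (fun t => fsymp X (gamma t)) ->
  exists P : {vspace 'rV[R]_(n + n)},
    (\dim P = 2)%N /\
    (forall t, I t -> gamma t \in P /\ fsymp X (gamma t) \in P).
Proof.
move=> n0 [cX _] iX0 pX C2 itvI [gamma' [dg _ bg cg]] [delta' [dd _ _ cd]].
(* [bd_omega_eq1] provides a dual point, so [xget] returns one instead of its default 0. *)
have fP t : I t -> X (fsymp X (gamma t)) /\ omega (gamma t) (fsymp X (gamma t)) = 1.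
  move=> /bg/(bd_omega_eq1 cX iX0 pX)[y Xy xy].
  have [pd gd] := @xgetPex _ 0 [set y | symp_polar X y /\ omega (gamma t) y = 1]
    (ex_intro _ y (conj ((mem_self_polar pX y).1 Xy) xy)).
  by split; first exact: (mem_self_polar pX _).2 pd.
have Xg t : I t -> X (gamma t).
  move=> /bg[]; rewrite -(closure_id X).1//; exact: compact_closed cX.
set delta := fun t => fsymp X (gamma t) in dd cd.
(* Pairing [gamma' = a *: delta] with [gamma] recovers [a], so the coefficient is an explicit
   function of [t]. *)
have dg' t : I t ->
    has_deriv_within I gamma t (omega (gamma t) (gamma' t) *: delta t).
  move=> It; have [Xd gd] := fP t It; have := dg t It.
  have [a ->] := char_line_supporting cX iX0 pX C2 (Xg t It) Xd gd (cg t It).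
  by rewrite omegaZr gd mulr1.
(* The point of [X] dual to [delta t] is [- gamma t]. *)
have dd' t : I t ->
    has_deriv_within I delta t (- omega (delta t) (delta' t) *: gamma t).
  move=> It; have [Xd gd] := fP t It; have := dd t It.
  have Xng : X (- gamma t) by exact: self_polar_opp (Xg t It).
  have dng : omega (delta t) (- gamma t) = 1 by rewrite omegaNr -omegaC.
  have [b ->] := char_line_supporting cX iX0 pX C2 Xd Xng dng (cd t It).
  by rewrite omegaZr dng mulr1 scaleNr -scalerN.
have omega1 t : I t -> omega (gamma t) (delta t) = 1 by move=> /fP[].
(* For empty [I] any plane will do; otherwise the plane at one time [s] contains both curves. *)
have [I0|/set0P[s Is]] := eqVneq I set0.
  have [u [v uv]] := exists_omega_eq1 R n0.
  exists <<[:: u; v]>>%VS; split; first exact: dim_span_omega1.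
  by rewrite I0.
exists <<[:: gamma s; delta s]>>%VS; split.
  exact/dim_span_omega1/omega1.
have [gs ds] : gamma s \in <<[:: gamma s; delta s]>>%VS /\
    delta s \in <<[:: gamma s; delta s]>>%VS.
  by split; apply: memv_span; rewrite !inE eqxx ?orbT.
move=> t It; rewrite -/(delta t); split.
  rewrite (gamma_planar itvI dg' dd' omega1 Is It).
  by apply: rpredB; apply: rpredZ.
rewrite (delta_planar itvI dg' dd' omega1 Is It).
by apply: rpredB; apply: rpredZ.
Qed.
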